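(* Let $\gamma\in(\lambda,\infty)$, $z\in\mathcal X$, and let $m\ge1$. For $y\in\mathbb R^d$ and a batch $B$ of $m$ samples put $$\hat y_B=\mathrm{prox}_{f_{z}/\gamma}(y,B)=\mathrm{argmin}_{x\in\mathcal X}\Big\{ f_{z}(x,B)+\frac{\gamma}{2}\|x-y\|^{2}\Big\}.$$ Then this stochastic proximal mapping is $\varepsilon$-stable with $\varepsilon=\frac{2L^{2}}{m(\gamma-\lambda)}$, i.e., for every $y$, $$\Big|\mathbb{E}_{B,B',i}\big[f_z(\hat y_{B_{(i)}},\xi_i')-f_z(\hat y_B,\xi_i')\big]\Big|\le\frac{2L^{2}}{m(\gamma-\lambda)}.$$
   Context: Setting: $\mathcal X\subseteq\mathbb R^d$ is a nonempty closed convex set, $\xi$ is a random sample with distribution $\Xi$, and $f(x)=\mathbb E_{\xi\sim\Xi}[f(x,\xi)]$. $\|\cdot\|$ is the Euclidean norm. A function $g$ is $\lambda$-weakly convex if $g+\frac{\lambda}{2}\|\cdot\|^2$ is convex. Each $f(\cdot,\xi)$ is continuous and $\mu$-weakly convex with $\mu<\lambda+\tau$. For each $x\in\mathcal X$ and $\xi$ a model function $f_x(\cdot,\xi)$ is given such that, for constants $\lambda\ge 0$, $\tau\ge 0$, $L>0$ and all $\xi\sim\Xi$: (i) for all $x\in\mathcal X$, $y\mapsto f_x(y,\xi)$ is $\lambda$-weakly convex; (ii) $f_x(x,\xi)=f(x,\xi)$ for all $x\in\mathcal X$; (iii) $f_x(y,\xi)-f(y,\xi)\le\frac{\tau}{2}\|x-y\|^2$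 for all $x,y\in\mathcal X$; (iv) $f_x(z,\xi)-f_x(y,\xi)\le L\|z-y\|$ for all $x,y,z\in\mathcal X$. Notation: $B=\{\xi_1,\dots,\xi_m\}$ is a batch of i.i.d. samples from $\Xi$, $B'=\{\xi_1',\dots,\xi_m'\}$ is an independent i.i.d. copy, $B_{(i)}$ is $B$ with $\xi_i$ replaced by $\xi_i'$, and $f_z(x,B)=\frac1m\sum_{j=1}^m f_z(x,\xi_j)$. The index $i$ is uniform on $\{1,\dots,m\}$, independent of $B,B'$. *)

(* Defs.v *)
From HB Require Import structures.
From mathcomp Require Export all_boot all_order all_algebra.
From mathcomp Require Export all_classical all_reals all_analysis.
Export Order.TTheory GRing.Theory Num.Theory.
Export numFieldNormedType.Exports.

Set Implicit Arguments.
Unset Strict Implicit.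
Unset Printing Implicit Defensive.

Local Open Scope classical_set_scope.
Local Open Scope ring_scope.

(* The library norm [`|x|] on ['rV[R]_d] is the sup norm. The matrix topology,
   used below for [closed] and [continuous], is the usual one on R^d. *)
Definition enorm (R : realType) (d : nat) (x : 'rV[R]_d) : R :=
  Num.sqrt (\sum_(i < d) x ord0 i ^+ 2).

(* Functions are total on R^d, so the domain [D] on which convexity is meant is
   explicit. *)
Definition weakly_convex (R : realType) (d : nat) (D : set 'rV[R]_d)
    (lambda : R) (g : 'rV[R]_d -> R) : Prop :=
  convex_function (E := 'rV[R]_d) D
    (fun x => g x + lambda / 2 * enorm x ^+ 2).

(* A chosen minimizer of [F] over [D]; the value is arbitrary when there is
   none. *)
Definition argmin (R : realType) (d : nat) (D : set 'rV[R]_d)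
    (F : 'rV[R]_d -> R) : 'rV[R]_d :=
  [get x | D x /\ forall w, D w -> F x <= F w].

Section batches.
Context (R : realType) (d m : nat) (S : Type).

(* [fm x y xi] stands for f_x(y, xi): the first argument is the base point. *)
Definition batch_model (fm : 'rV[R]_d -> 'rV[R]_d -> S -> R)
    (z x : 'rV[R]_d) (b : 'I_m -> S) : R :=
  m%:R^-1 * \sum_(j < m) fm z x (b j).

Definition prox (X : set 'rV[R]_d) (fm : 'rV[R]_d -> 'rV[R]_d -> S -> R)
    (gamma : R) (z y : 'rV[R]_d) (b : 'I_m -> S) : 'rV[R]_d :=
  argmin X (fun x => batch_model fm z x b + gamma / 2 * enorm (x - y) ^+ 2).

Definition replace_sample (b b' : 'I_m -> S) (i : 'I_m) : 'I_m -> S :=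
  fun j => if j == i then b' i else b j.

End batches.

Definition independent_systems (d : measure_display) (T : measurableType d)
    (R : realType) (P : probability T R) (K : finType)
    (F : K -> set (set T)) : Prop :=
  forall (J : {set K}) (A : K -> set T), (forall k, k \in J -> F k (A k)) ->
    P (\bigcap_(k in [set` J]) A k) = (\prod_(k in J) P (A k))%E.

(* The sigma-algebras generated by the 2m samples and the random index; the
   index takes values in the discrete space ['I_m]. *)
Definition sample_systems (d dS : measure_display) (T : measurableType d)
    (S : measurableType dS) (m : nat) (B B' : 'I_m -> T -> S) (idx : T -> 'I_m)
    (k : option ('I_m + 'I_m)) : set (set T) :=
  match k with
  | Some (inl j) => preimage_set_system setT (B j) measurable
  | Some (inr j) => preimage_set_system setT (B' j) measurable
  | None => preimage_set_system setT idx setT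
  end.

(* All 2m samples have law [Xi], the index is uniform on ['I_m], and the 2m
   samples and the index are mutually independent. *)
Definition resampling_scheme (d dS : measure_display) (T : measurableType d)
    (S : measurableType dS) (R : realType) (P : probability T R)
    (Xi : probability S R) (m : nat) (B B' : 'I_m -> {RV P >-> S})
    (idx : T -> 'I_m) : Prop :=
  [/\ forall j A, measurable A -> distribution P (B j) A = Xi A,
      forall j A, measurable A -> distribution P (B' j) A = Xi A,
      forall i, measurable (idx @^-1` [set i])
                /\ P (idx @^-1` [set i]) = (m%:R^-1)%:E
    & independent_systems P
        (sample_systems (fun j => B j : T -> S) (fun j => B' j : T -> S) idx)].

(* Main.v *)
(* The prox objective [F_B] is [gamma - lambda]-strongly convex, so with
   [u], [v] the minimizers for [B], [B_(i)] and [e = |u - v|], adding the two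
   quadratic growth inequalities at [u] and [v] cancels everything except the
   two samples that differ:
     (gamma - lambda) e^2 <= F_B(v) - F_B(u) + F_B(i)(u) - F_B(i)(v)
                          <= (2 L / m) e.
   Hence [e <= 2 L / (m (gamma - lambda))], and by Lipschitz continuity the
   integrand is bounded by [2 L^2 / (m (gamma - lambda))] at every sample
   point.  Minimizers exist because a
   Lipschitz function plus a quadratic is continuous and coercive. *)
Require Import Defs.
From mathcomp Require Import all_boot all_order all_algebra.
From mathcomp Require Import ring lra.
From mathcomp Require Import all_classical all_reals all_analysis.
Import Order.TTheory GRing.Theory Num.Theory.
Import numFieldNormedType.Exports.
Set Implicit Arguments.
Unset Strict Implicit.
Unset Printing Implicit Defensive.
Local Open Scope classical_set_scope.
Local Open Scope ring_scope.

(** * Euclidean norm: convexity defect, continuity, compact balls *)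

Section euclidean_norm.
Context {R : realType} {d : nat}.
Implicit Types x y : 'rV[R]_d.

Lemma enorm_ge0 x : 0 <= enorm x.
Proof. exact: sqrtr_ge0. Qed.

Lemma sqr_enorm x : enorm x ^+ 2 = \sum_(i < d) x ord0 i ^+ 2.
Proof. by rewrite sqr_sqrtr// sumr_ge0// => i _; exact: sqr_ge0. Qed.

Lemma enorm0 : enorm (0 : 'rV[R]_d) = 0.
Proof. by rewrite /enorm big1 ?sqrtr0// => i _; rewrite mxE expr0n. Qed.

Lemma enormN x : enorm (- x) = enorm x.
Proof. by congr Num.sqrt; apply: eq_bigr => i _; rewrite mxE sqrrN. Qed.

Lemma enorm_distC x y : enorm (x - y) = enorm (y - x).
Proof. by rewrite -enormN opprB. Qed.

(** The defect [t (1 - t) |x - y|^2] is exact, so adding a quadratic shifts a weak convexity modulus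
    with no loss. *)
Lemma sqr_enorm_conv (t : R) x y :
  enorm (t *: x + (1 - t) *: y) ^+ 2 =
  t * enorm x ^+ 2 + (1 - t) * enorm y ^+ 2 -
    t * (1 - t) * enorm (x - y) ^+ 2.
Proof.
rewrite !sqr_enorm !mulr_sumr -big_split -sumrB.
by apply: eq_bigr => i _; rewrite !mxE /=; ring.
Qed.

Lemma sqr_enormD_le x y :
  enorm (x + y) ^+ 2 <= 2 * enorm x ^+ 2 + 2 * enorm y ^+ 2.
Proof.
rewrite !sqr_enorm !mulr_sumr -big_split; apply: ler_sum => i _ /=.
rewrite mxE -subr_ge0; set a := x _ _; set b := y _ _.
by rewrite [leRHS](_ : _ = (a - b) ^+ 2) ?sqr_ge0//; ring.
Qed.

Lemma ler_coord_enorm x (i : 'I_d) : `|x ord0 i| <= enorm x.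
Proof.
rewrite -(@ler_pXn2r _ 2) ?nnegrE ?enorm_ge0// real_normK ?num_real//.
rewrite sqr_enorm (bigD1 i)//= lerDl sumr_ge0// => j _; exact: sqr_ge0.
Qed.

Lemma ler_norm_enorm x : `|x| <= enorm x.
Proof.
rewrite [leLHS]/Num.norm/= mx_normrE; apply: bigmax_le; first exact: enorm_ge0.
by move=> [i j] _ /=; rewrite (ord1 i) ler_coord_enorm.
Qed.

Lemma continuous_enorm : continuous (@enorm R d).
Proof.
move=> x; rewrite /enorm.
apply: (@continuous_comp _ _ _ (fun x : 'rV[R]_d => \sum_i x ord0 i ^+ 2)
  Num.sqrt); last exact: sqrt_continuous.
apply: (@cvg_big _ _ _ _ _ add_continuous _ _ _ _ _ (nbhs_filter x)) => i _.
by apply: cvgM; exact: coord_continuous.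
Qed.

Lemma continuous_enorm_dist y : continuous (fun x => enorm (x - y)).
Proof.
move=> x; apply: (@continuous_comp _ _ _ (fun x => x - y) (@enorm R d)).
  by apply: (@cvgB _ _ _ _ (nbhs_filter x)); [exact: cvg_id|exact: cvg_cst].
exact: continuous_enorm.
Qed.

Lemma continuous_affine_enorm (a b : R) y :
  continuous (fun x => a + b * enorm (x - y)).
Proof.
move=> x; apply: (@cvgD _ _ _ _ (nbhs_filter x)); first exact: cvg_cst.
apply: (@cvgM _ _ _ (nbhs_filter x)); first exact: cvg_cst.
exact: continuous_enorm_dist.
Qed.

Lemma continuous_sqr_enorm (b : R) y :
  continuous (fun x => b * enorm (x - y) ^+ 2).
Proof.
move=> x; apply: (@cvgM _ _ _ (nbhs_filter x)); first exact: cvg_cst.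
by apply: (@cvgM _ _ _ (nbhs_filter x)); exact: continuous_enorm_dist.
Qed.

(** Heine-Borel: the sup norm is dominated by [enorm], so Euclidean balls are bounded in the sense
    of the library. *)
Lemma compact_cball_enorm (X : set 'rV[R]_d) y (r : R) :
  closed X -> compact (X `&` [set x | enorm (x - y) <= r]).
Proof.
move=> Xcl; apply: bounded_closed_compact.
  exists (r + `|y|); split; first exact: num_real.
  move=> M rM x [_ /= xr]; apply: le_trans (ltW rM).
  rewrite -{1}(subrK y x) (le_trans (ler_normD _ _))// lerD2r.
  exact: le_trans (ler_norm_enorm _) xr.
apply: closedI => //.
apply: (@preimage_closed _ _ (fun x => enorm (x - y)) [set t | t <= r]).
  by move=> x _; exact: continuous_enorm_dist.
exact: closed_le.
Qed.

End euclidean_norm.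

(** * Weak convexity and quadratic growth at a minimizer *)

Section weak_convexity.
Context {R : realType} {d : nat}.
Implicit Types (X : set 'rV[R]_d) (g F : 'rV[R]_d -> R).

Lemma i01_ex (t : R) : 0 <= t <= 1 -> exists s : {i01 R}, s%:num = t.
Proof.
move=> t01.
have ts : Itv.spec (@Itv.num_sem R) (Itv.Real `[0%Z, 1%Z]) t.
  by rewrite /= /Itv.num_sem num_real in_itv.
by exists (Itv.mk ts).
Qed.

Lemma conv_rowE (s : {i01 R}) (x y : convex_lmodType 'rV[R]_d) :
  conv s x y = s%:num *: (x : 'rV[R]_d) + (1 - s%:num) *: (y : 'rV[R]_d).
Proof. by []. Qed.

(** By [sqr_enorm_conv] the squared norms of the end points cancel; what is left depends on [x - y]
    only and is translation invariant. *)
Lemma weakly_convexP X (l : R) g :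
  weakly_convex X l g <->
  forall (t : R) x y, 0 <= t <= 1 -> X x -> X y ->
    g (t *: x + (1 - t) *: y) <=
    t * g x + (1 - t) * g y + l / 2 * (t * (1 - t)) * enorm (x - y) ^+ 2.
Proof.
split=> [gcv t x y /i01_ex[s <-] Xx Xy|gcv s x y /set_mem Xx /set_mem Xy].
  have := gcv s x y (mem_set Xx) (mem_set Xy).
  by rewrite convRE conv_rowE sqr_enorm_conv /unstable.onem; lra.
rewrite convRE conv_rowE sqr_enorm_conv /unstable.onem.
by have := gcv s%:num x y _ Xx Xy; rewrite ge0 le1 => /(_ isT); lra.
Qed.

Lemma weakly_convex_batch_model (S : Type) (m : nat) X (l : R)
    (fm : 'rV[R]_d -> 'rV[R]_d -> S -> R) z (b : 'I_m -> S) :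
  (0 < m)%N -> (forall xi, weakly_convex X l (fun x => fm z x xi)) ->
  weakly_convex X l (fun x => batch_model fm z x b).
Proof.
move=> m0 fcv; apply/weakly_convexP => t x y t01 Xx Xy.
have m0' : (0 : R) < m%:R by rewrite ltr0n.
rewrite /batch_model -(ler_pM2l m0') mulVKf ?gt_eqF//.
set q := l / 2 * _ * _.
(* Giving each sample its own copy of the defect [q] lets the inequality be proved termwise. *)
rewrite (_ : m%:R * _ = \sum_(j < m) (t * fm z x (b j) +
  (1 - t) * fm z y (b j) + q)); last first.
  rewrite !big_split/= sumr_const card_ord -!mulr_sumr -mulr_natl.
  by field; rewrite gt_eqF.
by apply: ler_sum => j _; have /weakly_convexP := fcv (b j); exact.
Qed.

(** The centre [y] drops out because [(u - y) - (v - y) = u - v]. For [c > l] the new modulus is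
    negative, which is strong convexity. *)
Lemma weakly_convex_add_sqr_enorm X (l c : R) g y :
  weakly_convex X l g ->
  weakly_convex X (l - c) (fun x => g x + c / 2 * enorm (x - y) ^+ 2).
Proof.
move=> /weakly_convexP gcv; apply/weakly_convexP => t u v t01 Xu Xv.
have -> : t *: u + (1 - t) *: v - y = t *: (u - y) + (1 - t) *: (v - y).
  by rewrite !scalerBr addrACA -opprD -scalerDl subrKC scale1r.
rewrite sqr_enorm_conv opprB addrA subrK.
have := gcv t u v t01 Xu Xv; lra.
Qed.

(* Compare [u] with [t x + (1 - t) u] and let [t] tend to [0]. *)
Lemma strongly_convex_growth X (c : R) F u x :
  convex_set (M := 'rV[R]_d) X -> weakly_convex X (- c) F ->
  X u -> (forall w, X w -> F u <= F w) -> X x ->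
  F u + c / 2 * enorm (x - u) ^+ 2 <= F x.
Proof.
move=> Xcv /weakly_convexP Fcv Xu Fu Xx.
set q := c / 2 * _.
have key (t : R) : 0 < t -> t <= 1 -> (1 - t) * q <= F x - F u.
  move=> t0 t1.
  have t01 : 0 <= t <= 1 by rewrite ltW.
  have Xw : X (t *: x + (1 - t) *: u).
    have [s <-] := i01_ex t01.
    exact/set_mem/(Xcv x u s (mem_set Xx) (mem_set Xu)).
  have := le_trans (Fu _ Xw) (Fcv t x u t01 Xx Xu).
  by rewrite -(ler_pM2l t0 ((1 - t) * q)) /q; lra.
rewrite addrC -lerBrDr.
have [//|xuq] := leP q (F x - F u).
have Fxu : 0 <= F x - F u by rewrite subr_ge0 Fu.
have q0 : 0 < q by lra.
(* With this [t], [(1 - t) q] is the midpoint of [q] and [F x - F u], which exceeds [F x - F u] and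
   contradicts [key]. *)
pose t := (q - (F x - F u)) / (2 * q).
have tq : t * q = (q - (F x - F u)) / 2 by rewrite /t; field; rewrite gt_eqF.
have t0 : 0 < t by rewrite divr_gt0//; lra.
have t1 : t <= 1 by rewrite ler_pdivrMr; lra.
by have := key t t0 t1; lra.
Qed.

End weak_convexity.

(** * Existence of proximal points and their stability under one replacement *)

Section prox.
Context {R : realType} {d : nat}.
Implicit Types X : set 'rV[R]_d.

(** Near [x] inside [X], [h] is squeezed between [h x - L |v - x|] and [h x + L |v - x|]; exchanging
    [u] and [v] in the one-sided bound gives the lower side. *)
Lemma within_continuous_lipschitz X (h : 'rV[R]_d -> R) (L : R) :
  (forall u v, X u -> X v -> h v - h u <= L * enorm (v - u)) ->
  {within X, continuous h}.
Proof.
move=> hL; rewrite continuous_subspace_in /from_subspace => x /set_mem Xx.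
have cvg_hx (b : R) :
    h x + b * enorm (v - x) @[v --> (nbhs (x : subspace X))] --> h x.
  have : h x + b * enorm (v - x) @[v --> (nbhs (x : subspace X))] -->
      h x + b * enorm (x - x).
    exact: (continuous_subspaceT (@continuous_affine_enorm _ _ (h x) b x)).
  by rewrite subrr enorm0 mulr0 addr0.
apply: (squeeze_cvgr _ (cvg_hx (- L)) (cvg_hx L)).
rewrite /nbhs/= -(nbhs_subspace_in Xx); near=> v.
have Xv : X v by near: v; exact: withinT.
have := hL _ _ Xx Xv; have := hL _ _ Xv Xx.
by rewrite (enorm_distC x v) => ? ?; apply/andP; split=> /=; lra.
Unshelve. all: by end_near. Qed.

Lemma argminP X (F : 'rV[R]_d -> R) :
  (exists u, X u /\ forall w, X w -> F u <= F w) ->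
  X (argmin X F) /\ forall w, X w -> F (argmin X F) <= F w.
Proof.
exact: (@getPex _ [set u | X u /\ forall w, X w -> F u <= F w]).
Qed.

Lemma prox_objective_min_exists X (h : 'rV[R]_d -> R) (L c : R) y :
  X !=set0 -> closed X -> 0 <= L -> 0 < c ->
  (forall u v, X u -> X v -> h v - h u <= L * enorm (v - u)) ->
  let F x := h x + c / 2 * enorm (x - y) ^+ 2 in
  exists u, X u /\ forall w, X w -> F u <= F w.
Proof.
move=> [x0 Xx0] Xcl L0 c0 hL F.
set N := enorm (x0 - y) ^+ 2.
have N0 : 0 <= N by exact: sqr_ge0.
(* Outside this ball around [x0], with [e = |w - x0|], one gets [F w - F x0 >= c/4 e^2 - L e - c N].
   The summand [1] forces [e >= 1], hence [c N <= c N e]; the other summand gives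
   [L + c N <= c/4 e]. So [F w >= F x0], and a minimizer over the ball is global. *)
pose r := 1 + 4 / c * (L + c * N).
have c0' := ltW c0.
have r1 : 1 <= r by rewrite lerDl mulr_ge0// ?divr_ge0// addr_ge0// mulr_ge0.
have Fcont : {within X, continuous F}.
  move=> x; apply: cvgD; first exact: (within_continuous_lipschitz hL).
  exact: (continuous_subspaceT (@continuous_sqr_enorm R d (c / 2) y)).
have Kx0 : (X `&` [set x | enorm (x - x0) <= r]) x0.
  by split => //=; rewrite subrr enorm0; lra.
have [] := @EVT_min_rV R d F (X `&` [set x | enorm (x - x0) <= r]).
- by exists x0.
- exact: compact_cball_enorm.
- by apply: continuous_subspaceW Fcont; exact: subIsetl.
move=> u /set_mem[Xu _] Fu; exists u; split=> // w Xw.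
have [wr|rw] := leP (enorm (w - x0)) r; first exact/Fu/mem_set.
apply: le_trans (Fu _ (mem_set Kx0)) _; rewrite /F -/N.
have := hL _ _ Xw Xx0; rewrite enorm_distC.
have : enorm (w - x0) ^+ 2 <= 2 * enorm (w - y) ^+ 2 + 2 * N.
  have -> : w - x0 = (w - y) + (y - x0) by rewrite addrA subrK.
  by rewrite /N (enorm_distC x0 y) sqr_enormD_le.
set e := enorm (w - x0) in rw *; set M := enorm (w - y) ^+ 2 => eM hLe.
have ce : L + c * N <= c / 4 * e.
  have : c / 4 * r <= c / 4 * e by rewrite ler_pM2l ?divr_gt0// ltW.
  have -> : c / 4 * r = c / 4 + (L + c * N).
    by rewrite /r; field; rewrite gt_eqF.
  by apply: le_trans; rewrite lerDr divr_ge0// ltW.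
have e1 : 1 <= e by lra.
have cee : (L + c * N) * e <= c / 4 * e ^+ 2.
  by rewrite expr2 mulrA ler_wpM2r//; lra.
have cNe : c * N <= c * N * e by rewrite ler_peMr// mulr_ge0// ltW.
have ceM : c / 4 * e ^+ 2 <= c / 4 * (2 * M + 2 * N).
  by rewrite ler_pM2l// divr_gt0.
lra.
Qed.

Lemma sum_replace_sample (S : Type) (m : nat) (g : S -> R)
    (b b' : 'I_m -> S) i :
  \sum_(j < m) g (replace_sample b b' i j) =
  \sum_(j < m) g (b j) - g (b i) + g (b' i).
Proof.
rewrite (bigD1 i)//= [in RHS](bigD1 i)//= /replace_sample eqxx.
rewrite (eq_bigr (fun j => g (b j))) => [|j /negPf->//].
by ring.
Qed.

Context {S : Type} (X : set 'rV[R]_d) (fm : 'rV[R]_d -> 'rV[R]_d -> S -> R).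
Variables (lambda gamma L : R) (z y : 'rV[R]_d) (m : nat).
Hypotheses (X0 : X !=set0) (Xcl : closed X)
  (Xcv : convex_set (M := 'rV[R]_d) X)
  (lambda0 : 0 <= lambda) (lambda_gamma : lambda < gamma)
  (L0 : 0 <= L) (m0 : (0 < m)%N).
Hypothesis fm_cvx : forall xi, weakly_convex X lambda (fun x => fm z x xi).
Hypothesis fm_lip : forall xi u v, X u -> X v ->
  fm z v xi - fm z u xi <= L * enorm (v - u).

Lemma proxP (b : 'I_m -> S) (u := prox X fm gamma z y b)
    (F := fun x => batch_model fm z x b + gamma / 2 * enorm (x - y) ^+ 2) :
  X u /\ forall w, X w ->
    F u + (gamma - lambda) / 2 * enorm (w - u) ^+ 2 <= F w.
Proof.
have [Xu Fu] : X u /\ forall w, X w -> F u <= F w.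
  apply: argminP; apply: (prox_objective_min_exists (L := L)) => //.
    exact: le_lt_trans lambda_gamma.
  move=> v w Xv Xw; rewrite /batch_model -mulrBr -sumrB mulrC.
  rewrite ler_pdivrMr ?ltr0n// mulr_natr.
  (* The bound becomes a sum of [m] equal terms, one Lipschitz estimate per sample. *)
  rewrite -[in X in _ *+ X](card_ord m) -sumr_const.
  by apply: ler_sum => j _; exact: fm_lip.
split=> // w Xw; apply: (strongly_convex_growth Xcv) => //.
rewrite opprB; apply: weakly_convex_add_sqr_enorm.
exact: weakly_convex_batch_model.
Qed.

Lemma prox_replace_dist (b b' : 'I_m -> S) (i : 'I_m) :
  enorm (prox X fm gamma z y (replace_sample b b' i) - prox X fm gamma z y b)
    <= 2 * L / (m%:R * (gamma - lambda)).
Proof.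
have [] := proxP b; have [] := proxP (replace_sample b b' i).
set v := prox _ _ _ _ _ (replace_sample _ _ _); set u := prox _ _ _ _ _ b.
move=> Xv Fv Xu Fu; have := Fv _ Xu; have := Fu _ Xv.
have mR0 : (0 : R) < m%:R by rewrite ltr0n.
rewrite /batch_model !(sum_replace_sample (fm z _)) (enorm_distC u v).
have := fm_lip (b i) Xu Xv; have := fm_lip (b' i) Xv Xu.
rewrite (enorm_distC u v).
set e := enorm (v - u) => h1 h2.
rewrite -(ler_pM2l mR0) => Hu; rewrite -(ler_pM2l mR0) => Hv.
(* The inequalities add up to [m (gamma - lambda) e^2 <= 2 L e]; cancelling a factor [e] requires
   [e] to be nonzero. *)
have [->|e0] := eqVneq e 0.
  by rewrite divr_ge0// mulr_ge0// ?ler0n// subr_ge0 ltW.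
have {}e0 : 0 < e by rewrite lt_neqAle eq_sym e0 enorm_ge0.
rewrite ler_pdivlMr ?mulr_gt0 ?subr_gt0// -(ler_pM2r e0).
move: Hu Hv; rewrite !mulrDr !mulVKf ?gt_eqF//; lra.
Qed.

(** Lipschitz continuity costs one more factor [L]. As [xi] is arbitrary, it may be the replacing
    sample [b' i]. *)
Lemma model_prox_replace_dist (b b' : 'I_m -> S) (i : 'I_m) xi :
  `|fm z (prox X fm gamma z y (replace_sample b b' i)) xi -
    fm z (prox X fm gamma z y b) xi| <= 2 * L ^+ 2 / (m%:R * (gamma - lambda)).
Proof.
have [Xu _] := proxP b; have [Xv _] := proxP (replace_sample b b' i).
have := fm_lip xi Xu Xv; have := fm_lip xi Xv Xu.
have := ler_wpM2l L0 (prox_replace_dist b b' i).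
rewrite ler_norml (enorm_distC (prox _ _ _ _ _ b)).
set D := _ * (_ - _); have -> : L * (2 * L / D) = 2 * L ^+ 2 / D by ring.
by move=> ? ? ?; apply/andP; split; lra.
Qed.

End prox.

(** * Expectation of a bounded function *)

Section bounded_expectation.
Import HBNNSimple.

(* The integrals of [Y^+] and [Y^-] are suprema over the simple functions below
   them, hence lie in [0, c] even when [Y] is not measurable. *)
Lemma abse_expectation_le (R : realType) (dT : measure_display)
    (T : measurableType dT) (P : probability T R) (Y : T -> R) (c : R) :
  0 <= c -> (forall w, `|Y w| <= c) -> (`|'E_P[Y]| <= c%:E)%E.
Proof.
move=> c0 Yc.
have bound (g : T -> \bar R) : (forall w, 0 <= g w)%E ->
    (forall w, g w <= c%:E)%E -> (0 <= \int[P]_w g w <= c%:E)%E.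
  move=> g0 gc; rewrite integral_ge0//= ge0_integralTE//.
  apply/ge_ereal_sup => _ [h hg <-].
  (* Since [P] has total mass 1, [c] is the integral of a constant simple function, and monotonicity
     among simple functions applies. *)
  have -> : c%:E = sintegral P (cst_nnsfun T (NngNum c0)).
    rewrite -[LHS]mule1 -(probability_setT P).
    by have := sintegral_EFin_cst P setT (NngNum c0); rewrite patch_setT.
  by apply: le_sintegral => w; rewrite -lee_fin (le_trans (hg w)).
have /andP[p0 pc] : (0 <= \int[P]_w ((EFin \o Y)^\+ w) <= c%:E)%E.
  apply: bound => w; first exact: funepos_ge0.
  by rewrite funeposE ge_max !lee_fin c0 (le_trans (ler_norm _) (Yc w)).
have /andP[n0 nc] : (0 <= \int[P]_w ((EFin \o Y)^\- w) <= c%:E)%E.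
  apply: bound => w; first exact: funeneg_ge0.
  rewrite funenegE ge_max !lee_fin c0 andbT.
  by rewrite (le_trans (ler_norm _))// normrN.
(* The expectation is the difference of two numbers in [[0, c]], hence lies in [[-c, c]]; the bounds
   exclude the infinite cases. *)
rewrite unlock integralE.
move: (integral _ _ _) p0 pc (integral _ _ _) n0 nc.
case=> [a||]//= a0 ac [b||]//= b0 bc.
by rewrite !lee_fin in a0 ac b0 bc *; rewrite ler_norml; apply/andP; split; lra.
Qed.

End bounded_expectation.

Theorem lemma3p1 (R : realType) (d : nat)
  (X : set 'rV[R]_d) (hX0 : X !=set0) (hXcl : closed X)
  (hXcv : convex_set (M := 'rV[R]_d) X)
  (dS : measure_display) (S : measurableType dS) (Xi : probability S R)
  (f : 'rV[R]_d -> S -> R) (fm : 'rV[R]_d -> 'rV[R]_d -> S -> R)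
  (lambda tau L mu : R)
  (hlambda : 0 <= lambda) (htau : 0 <= tau) (hL : 0 < L)
  (hmu : mu < lambda + tau)
  (hfcont : forall xi, {within X, continuous (fun x => f x xi)})
  (hfwc : forall xi, weakly_convex X mu (fun x => f x xi))
  (hfmmeas : forall x y, X x -> X y -> measurable_fun [set: S] (fm x y))
  (hi : forall xi x, X x -> weakly_convex X lambda (fun y => fm x y xi))
  (hii : forall xi x, X x -> fm x x xi = f x xi)
  (hiii : forall xi x y, X x -> X y ->
     fm x y xi - f y xi <= tau / 2 * enorm (x - y) ^+ 2)
  (hiv : forall xi x y z, X x -> X y -> X z ->
     fm x z xi - fm x y xi <= L * enorm (z - y))
  (gamma : R) (hgamma : lambda < gamma)
  (z : 'rV[R]_d) (hz : X z) (m : nat) (hm : (0 < m)%N)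
  (dT : measure_display) (T : measurableType dT) (P : probability T R)
  (B B' : 'I_m -> {RV P >-> S}) (idx : T -> 'I_m)
  (hB : resampling_scheme Xi B B' idx)
  (y : 'rV[R]_d) :
  let batch w := fun j => B j w in
  let batch' w := fun j => B' j w in
  let i_batch w := replace_sample (batch w) (batch' w) (idx w) in
  let yhat b := prox X fm gamma z y b in
  (`| 'E_P[fun w => (fm z (yhat (i_batch w)) (batch' w (idx w))
                  - fm z (yhat (batch w)) (batch' w (idx w)))%R] |
     <= (2 * L ^+ 2 / (m%:R * (gamma - lambda)))%:E)%E.
Proof.
cbv zeta; apply: abse_expectation_le => [|w].
  by rewrite divr_ge0// mulr_ge0// ?sqr_ge0// subr_ge0 ltW.
(* The bound holds at each outcome [w], with [xi] the sample [batch' w (idx w)]. *)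
apply: (model_prox_replace_dist y hX0 hXcl hXcv hlambda hgamma (ltW hL) hm).
  by move=> xi; exact: hi.
by move=> xi u v Xu Xv; exact: hiv.
Qed.
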